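(* Let $(E,R,\sigma,F_\bullet)$ be a length-$n$ Chebyshev-filtered datum over a field $\Bbbk$ (as defined in the context, with associated $D,\Theta,\Xi,\mathcal G,\mathcal J$). Then for every $M\geq n$ and every $(k_1,\ldots,k_M)\in\mathbb{Z}^M$, $$\Xi\Theta^{k_1}\Xi\Theta^{k_2}\Xi\cdots\Xi\Theta^{k_M}\Xi=0,$$ whereas the word with $M=n-1$ and all exponents equal to one, $(\Xi\Theta)^{n-1}\Xi$, is nonzero. Moreover, $$\mathcal J=\operatorname{rad}\mathcal G,\qquad \mathcal J^{\,n}\neq0,\qquad \mathcal J^{\,n+1}=0,$$ where $\operatorname{rad}\mathcal{G}$ is the Jacobson radical, so that $\mathcal G$ has exactly $n+1$ nonzero Loewy layers $\mathcal J^{r}/\mathcal J^{r+1}$ (with $\mathcal J^0=\mathcal G$).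
   Context: Definition. Let $\Bbbk$ be a field, $E$ a finite-dimensional $\Bbbk$-vector space, $n\geq2$ an integer, and $R,\sigma\in\operatorname{GL}(E)$. Set $$C=R+R^{-1},\qquad D=\sigma(R-R^{-1}),$$ and, on $E\oplus E$, $$\Theta=\begin{pmatrix}R^{-1}&0\\ R-R^{-1}&R\end{pmatrix},\qquad \Xi=\begin{pmatrix}0&\sigma\\0&0\end{pmatrix}.$$ Let $\mathcal G=\Bbbk\langle I,\Theta,\Xi\rangle\subseteq\operatorname{End}(E\oplus E)$ be the unital subalgebra generated by $\Theta$ and $\Xi$, and $\mathcal J=\mathcal G\,\Xi\,\mathcal G$ the two-sided ideal generated by $\Xi$. The tuple $(E,R,\sigma,F_\bullet)$ is a length-$n$ Chebyshev-filtered datum if $F_\bullet$ is a flag of subspaces $0=F_0\subset F_1\subset\cdots\subset F_n=E$ such that (H1) $CF_r\subseteq F_r$ for $1\leq r\leq n$; (H2) $DF_r\subseteq F_{r-1}$ for $1\leq r\leq n$; (H3) $D^{\,n-1}\neq0$; (H4) the algebra $\Bbbk[\Theta,\Theta^{-1}]$ is semisimple. No dimension is prescribed for the quotients $F_r/F_{r-1}$. *)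

(* Defs.v *)
From HB Require Import structures.
From mathcomp Require Import all_boot all_order all_algebra all_field.

Set Implicit Arguments.
Unset Strict Implicit.
Unset Printing Implicit Defensive.

Import GRing.Theory.
Local Open Scope ring_scope.

(* The algebra of endomorphisms of a nonzero space V, with product
   f * g = f \o g.  The library's FalgLfun uses the opposite product and is
   restricted to endomorphisms of algebras, hence this alias. *)
Definition endo (F : fieldType) (V : vectType F) (hV : (0 < dim V)%N) :=
  'End(V).

Section EndoAlgebra.
Variables (F : fieldType) (V : vectType F) (hV : (0 < dim V)%N).

HB.instance Definition _ := Vector.on (endo hV).
HB.instance Definition _ := GRing.Zmodule_isNzRing.Build (endo hV)
  (@comp_lfunA _ _ _ _ _) (@comp_lfun1l _ _ _) (@comp_lfun1r _ _ _)
  (@comp_lfunDl _ _ _ _) (@comp_lfunDr _ _ _ _) (lfun1_neq0 hV).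
HB.instance Definition _ :=
  GRing.Lmodule_isLalgebra.Build F (endo hV) (@comp_lfunZl _ _ _ _).
HB.instance Definition _ :=
  GRing.Lalgebra_isAlgebra.Build F (endo hV) (@comp_lfunZr _ _ _ _).
HB.instance Definition _ := Algebra_isFalgebra.Build F (endo hV).

Lemma endo_mulE (f g : endo hV) : f * g = (f \o g)%VF. Proof. by []. Qed.

End EndoAlgebra.

(* Ideals of a unital subalgebra B of A.  As B contains the scalars, its left
   ideals are subspaces. *)
Section Ideals.
Variables (F : fieldType) (A : falgType F).
Implicit Types B I K : {vspace A}.

Definition left_ideal B I := (I <= B)%VS /\ (B * I <= I)%VS.

Definition maximal_left_ideal B I :=
  [/\ left_ideal B I, I <> B
    & forall K, left_ideal B K -> (I <= K)%VS -> K = I \/ K = B].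

Definition simple_left_ideal B I :=
  [/\ left_ideal B I, I <> 0%VS
    & forall K, left_ideal B K -> (K <= I)%VS -> K = 0%VS \/ K = I].

Definition in_jacobson_radical B (x : A) :=
  x \in B /\ forall I, maximal_left_ideal B I -> x \in I.

(* The left regular module of B is a sum of simple submodules; finitely many
   suffice, since B is finite-dimensional. *)
Definition semisimple_algebra B :=
  exists s : seq {vspace A},
    (forall I, I \in s -> simple_left_ideal B I) /\ (\sum_(I <- s) I)%VS = B.

(* The powers of an ideal I of B, starting from B itself: in the library,
   (I ^+ 0)%VS is the line of scalars. *)
Definition ideal_power B I (r : nat) : {vspace A} :=
  if r is 0 then B else (I ^+ r)%VS.

End Ideals.

Section BlockEndomorphism.
Variables (F : fieldType) (E : vectType F) (a b c d : 'End(E)).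

Definition block_fun (u : E * E) : E * E :=
  (a u.1 + b u.2, c u.1 + d u.2).

Fact block_fun_is_linear : linear block_fun.
Proof.
move=> k u v; rewrite /block_fun /= !linearP.
by congr (_, _); rewrite /= scalerDr addrACA.
Qed.

HB.instance Definition _ :=
  GRing.isLinear.Build F (E * E)%type (E * E)%type _ block_fun
    block_fun_is_linear.

(* The endomorphism of E (+) E with matrix (a b; c d). *)
Definition block_endo : 'End((E * E)%type) := linfun block_fun.

Lemma block_endoE u : block_endo u = (a u.1 + b u.2, c u.1 + d u.2).
Proof. by rewrite lfunE. Qed.

End BlockEndomorphism.

Section Chebyshev.
Variables (F : fieldType) (E : vectType F).
Implicit Types R sigma : 'End(E).

Definition chebC R : 'End(E) := R + (R^-1)%VF.
Definition chebD R sigma : 'End(E) := (sigma \o (R - (R^-1)%VF))%VF.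
Definition chebTheta R : 'End((E * E)%type) :=
  block_endo (R^-1)%VF 0 (R - (R^-1)%VF) R.
Definition chebXi sigma : 'End((E * E)%type) := block_endo 0 sigma 0 0.

Definition lfun_pow (f : 'End(E)) (m : nat) : 'End(E) :=
  iter m (comp_lfun f) \1%VF.

Lemma dim_pair_gt0 (f : 'End(E)) : f <> 0 -> (0 < dim (E * E)%type)%N.
Proof.
move=> f0; rewrite -dimvf lt0n; apply/negP; rewrite dimv_eq0 => /eqP V0.
apply: f0; apply/lfunP => x; have := memvf ((x, 0) : (E * E)%type).
by rewrite V0 memv0 => /eqP [->]; rewrite !linear0.
Qed.

(* The hypothesis cheb_H3 makes E nonzero, so that End(E (+) E) is a nonzero
   ring, which the library's algebras have to be. *)
Record chebyshev_datum (n : nat) R sigma (Fl : nat -> {vspace E}) : Prop :=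
  ChebyshevDatum {
    cheb_length : (2 <= n)%N;
    cheb_R_GL : bijective R;
    cheb_sigma_GL : bijective sigma;
    cheb_flag0 : Fl 0 = 0%VS;
    cheb_flag_strict :
      forall r, (r < n)%N -> (Fl r <= Fl r.+1)%VS /\ Fl r <> Fl r.+1;
    cheb_flagn : Fl n = fullv;
    cheb_H1 : forall r, (1 <= r <= n)%N -> (chebC R @: Fl r <= Fl r)%VS;
    cheb_H2 : forall r, (1 <= r <= n)%N ->
                (chebD R sigma @: Fl r <= Fl r.-1)%VS;
    cheb_H3 : lfun_pow (chebD R sigma) n.-1 <> 0;
    cheb_H4 : let Theta : endo (dim_pair_gt0 cheb_H3) := chebTheta R in
              semisimple_algebra <<1 & [:: Theta; Theta^-1]>>%VS
  }.

Definition cheb_alg n R sigma Fl (h : @chebyshev_datum n R sigma Fl) :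
    falgType F :=
  endo (dim_pair_gt0 (cheb_H3 h)).

End Chebyshev.

(* Main.v *)
(* As Theta + Theta^-1 acts on E (+) E as C on each summand, the subspaces
   W_r = (F_r (+) 0) + Theta (F_r (+) 0) are stable under Theta, and Xi maps
   W_r into W_(r-1), because Xi Theta (u, 0) = (D u, 0).  The image of Xi lies
   in W_n, so that 0 = W_0 <= ... <= W_n <= E (+) E is a chain of n + 1 steps
   which G preserves and J lowers: J^(n+1) = 0, and every word with at least
   n + 1 letters Xi vanishes.  On the other hand (Xi Theta)^(n-1) Xi maps
   (x, y) to (D^(n-1) sigma y, 0), hence is a nonzero element of J^n.
   A nilpotent ideal lies in every maximal left ideal.  Conversely
   G = T + J with T = k[Theta, Theta^-1] semisimple; if v lies in a simple left
   ideal of T, then {g in G | g v in J} is G or a maximal left ideal, so an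
   element x of the radical satisfies x v in J; summing over the simple
   ideals gives x = x 1 in J. *)

Require Import Defs.
From HB Require Import structures.
From mathcomp Require Import all_boot all_order all_algebra all_field.

Set Implicit Arguments.
Unset Strict Implicit.
Unset Printing Implicit Defensive.

Import GRing.Theory.
Local Open Scope ring_scope.

(** * The radical as a nilpotent ideal with a semisimple complement *)

Section JacobsonRadical.
Variables (F : fieldType) (A : falgType F).
Implicit Types (B T I J S : {vspace A}) (x v : A).

(** Otherwise [I + J = B], so 1 = i + j. Then j^k = j^k i + j^(k+1), and membership in [I] descends
    from j^m = 0 to j^0 = 1. *)
Lemma nilpotent_ideal_sub_maximal B I J m :
    1 \in B -> left_ideal B J -> (J ^+ m = 0)%VS ->
  maximal_left_ideal B I -> (J <= I)%VS.
Proof.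
move=> B1 [sJB sBJ] Jm0 [[sIB sBI] neIB maxI].
have: (I + J)%VS = I \/ (I + J)%VS = B.
  apply: maxI; last exact: addvSl.
  by split; [rewrite subv_add sIB | rewrite prodvDr addvS].
case=> [<-|defB]; first exact: addvSr.
have /memv_addP[i Ii [j Jj def1]]: 1 \in (I + J)%VS by rewrite defB.
have BX k : j ^+ k \in B.
  elim: k => [|k IHk]; first by rewrite expr0.
  by rewrite exprSr; apply: (subvP sJB); apply: (prodvP sBJ).
have descent k : j ^+ k.+1 \in I -> j ^+ k \in I.
  move=> IjS; rewrite -[j ^+ k]mulr1 def1 mulrDr -exprSr memvD //.
  exact: (prodvP sBI).
have Ijm : j ^+ m \in I.
  suff: j ^+ m \in (J ^+ m)%VS by rewrite Jm0 memv0 => /eqP->; apply: mem0v.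
  elim: {Jm0} m => [|m IHm]; first by rewrite expr0 memv_line.
  by rewrite exprS expvSl memv_mul.
have I1 : 1 \in I by elim: {Jm0} m Ijm => [|m IHm /descent].
case: neIB; apply/eqP; rewrite eqEsubv sIB; apply/subvP => y By.
by rewrite -[y]mulr1; apply: (prodvP sBI).
Qed.

Lemma radical_mul_simple B T J S x v :
    (B * B <= B)%VS -> 1 \in B -> (T <= B)%VS -> 1 \in T -> (T * T <= T)%VS ->
    left_ideal B J -> (J * B <= J)%VS -> (B <= T + J)%VS ->
    simple_left_ideal T S -> v \in S ->
  in_jacobson_radical B x -> x * v \in J.
Proof.
move=> sBB B1 sTB T1 sTT [sJB sBJ] sJrB sBTJ [[sST sTS] _ minS] Sv [Bx radx].
have Bv : v \in B by apply: (subvP sTB); apply: (subvP sST).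
have [Jv|notJv] := boolP (v \in J); first exact: (prodvP sBJ).
(* The annihilator of [v] modulo [J], to be shown maximal. *)
pose I := (B :&: amulr v @^-1: J)%VS.
have memI y : (y \in I) = (y \in B) && (y * v \in J).
  by rewrite memv_cap -memv_preim lfunE.
suff /radx : maximal_left_ideal B I by rewrite memI => /andP[].
split=> [|eqIB|K [sKB sBK] sIK].
- split; first exact: capvSl.
  apply/prodvP => y z By; rewrite !memI => /andP[Bz Jzv].
  by rewrite (prodvP sBB) // -mulrA (prodvP sBJ).
- by move: B1; rewrite -eqIB memI mul1r (negPf notJv) andbF.
have [sKI|/subvPn[k Kk]] := boolP (K <= I)%VS.
  by left; apply/eqP; rewrite eqEsubv sKI.
have Bk := subvP sKB k Kk.
rewrite memI Bk /= => notJkv; right; apply/eqP; rewrite eqEsubv sKB.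
have /memv_addP[t Tt [j Jj def_k]] := subvP sBTJ k Bk.
have Jjv : j * v \in J by apply: (prodvP sJrB).
(* [t * v] is nonzero, as otherwise k v = j v would lie in [J]; hence it generates the simple ideal
   [S]. *)
have defS : (T * <[t * v]>)%VS = S.
  have Stv : t * v \in S by apply: (prodvP sTS).
  have sUS : (T * <[t * v]> <= S)%VS.
    by apply: subv_trans sTS; apply: prodvSr; rewrite -memvE.
  have [|||//] := minS (T * <[t * v]>)%VS => //.
    by split; [apply: subv_trans sST | rewrite prodvA prodvSl].
  move=> eq0; have := memv_mul T1 (memv_line (t * v)).
  rewrite eq0 memv0 mul1r => /eqP tv0.
  by case/negP: notJkv; rewrite def_k mulrDl tv0 add0r.
have /memv_cosetP[u Tu def_v] : v \in (T * <[t * v]>)%VS by rewrite defS.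
have Bu := subvP sTB u Tu.
(* From v = u t v follows (1 - u k) v = - u j v in [J], so 1 - u k lies in [I], hence in [K]. *)
have K1 : 1 \in K.
  rewrite -(subrK (u * k) 1) memvD ?(prodvP sBK) //.
  apply: (subvP sIK); rewrite memI memvB ?(prodvP sBB) //=.
  rewrite mulrBl mul1r def_k mulrDr mulrDl -!mulrA -def_v opprD addNKr.
  by rewrite memvN (prodvP sBJ).
by apply/subvP => y By; rewrite -[y]mulr1; apply: (prodvP sBK).
Qed.

Lemma nilpotent_ideal_semisimple_complement B T J m :
    (B * B <= B)%VS -> 1 \in B -> (T <= B)%VS -> 1 \in T -> (T * T <= T)%VS ->
    left_ideal B J -> (J * B <= J)%VS -> (J ^+ m = 0)%VS ->
    (B <= T + J)%VS -> semisimple_algebra T ->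
  forall x, x \in J <-> in_jacobson_radical B x.
Proof.
move=> sBB B1 sTB T1 sTT idJ sJB Jm0 sBTJ [s [simple_s sum_s]] x; split.
  move=> Jx; split; first exact: (subvP idJ.1).
  by move=> I maxI; apply: (subvP (nilpotent_ideal_sub_maximal B1 idJ Jm0 maxI)).
move=> radx; suff: amull x 1 \in J by rewrite lfunE /= mulr1.
(* The v with x v in [J] form a subspace, so it suffices that it contains each simple summand of
   [T]. *)
rewrite memv_preim; move: (T1); rewrite -{1}sum_s; apply: subvP.
rewrite big_seq; apply: (big_ind (fun U => (U <= _)%VS)) => [|U V sU sV|S sS].
- exact: sub0v.
- by rewrite subv_add sU.
apply/subvP => v Sv; rewrite -memv_preim lfunE /=.
exact: (radical_mul_simple sBB B1 sTB T1 sTT idJ sJB sBTJ (simple_s S sS)).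
Qed.

(* J^r = J^(r+1) would propagate to all larger exponents. *)
Lemma ideal_power_layers B J n :
    1 \in B -> left_ideal B J ->
    (J ^+ n)%VS <> 0%VS -> (J ^+ n.+1 = 0)%VS ->
  forall r, (ideal_power B J r.+1 <= ideal_power B J r)%VS /\
    (ideal_power B J r <> ideal_power B J r.+1 <-> (r < n.+1)%N).
Proof.
move=> B1 [sJB sBJ] Jn0 JS0 r; split.
  case: r => [|r]; first exact: sJB.
  rewrite /ideal_power expvSl [(J ^+ r.+1)%VS]expvSl.
  rewrite prodvA prodvSl //.
  by apply: subv_trans sBJ; apply: prodvSl.
split=> [|ltrn eqr].
  apply: contra_notT; rewrite -leqNgt => lenr.
  have J0 k : (n < k)%N -> (J ^+ k = 0)%VS.
    by move=> /subnKC<-; rewrite expvD JS0 prod0v.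
  by case: r lenr => // r lenr; rewrite /ideal_power !J0 // ltnW.
case: r => [|r] in ltrn eqr.
  have J1 : 1 \in J by rewrite -[J]/(ideal_power B J 1) -eqr.
  have: 1 \in (J ^+ n.+1)%VS.
    elim: {Jn0 JS0 ltrn} n => [//|n IHn].
    by rewrite expvSl -[1]mulr1 memv_mul.
  by rewrite JS0 memv0 oner_eq0.
apply: Jn0; rewrite -JS0; move: ltrn; rewrite ltnS => /subnKC<-.
by rewrite -addSn !expvD [(J ^+ r.+1)%VS]eqr.
Qed.

End JacobsonRadical.

(** * Endomorphisms lowering a chain of subspaces *)

Section MapsInto.
Variables (F : fieldType) (V : vectType F) (hV : (0 < dim V)%N).
Implicit Types (S T U : {vspace V}) (f : endo hV).

(** Written as the kernel of f -> (1 - p_T) f p_S, the condition defines a subspace, which can be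
    compared with products of ideals. *)
Definition maps_into S T : {vspace endo hV} :=
  lker (amull ((1 : endo hV) - projv T) \o amulr (projv S : endo hV))%VF.

Lemma maps_intoP f S T :
  reflect (forall x, x \in S -> (f : 'End(V)) x \in T) (f \in maps_into S T).
Proof.
rewrite memv_ker comp_lfunE !lfunE /=.
have val x : (((1 : endo hV) - projv T) * (f * (projv S : endo hV)) : 'End(V)) x
    = (f : 'End(V)) (projv S x) - projv T ((f : 'End(V)) (projv S x)).
  by rewrite endo_mulE comp_lfunE endo_mulE comp_lfunE add_lfunE opp_lfunE id_lfunE.
apply: (iffP eqP) => [f0 x Sx|fST].
  move: (val x); rewrite f0 zero_lfunE projv_id // => /esym/eqP.
  by rewrite subr_eq0 => /eqP->; apply: memv_proj.
apply/lfunP => x; rewrite val zero_lfunE [projv T _]projv_id ?subrr //.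
by apply: fST; apply: memv_proj.
Qed.

Lemma maps_intoM S T U : (maps_into T U * maps_into S T <= maps_into S U)%VS.
Proof.
apply/prodvP => f g /maps_intoP fTU /maps_intoP gST; apply/maps_intoP => x Sx.
by rewrite endo_mulE comp_lfunE fTU ?gST.
Qed.

Lemma adjoin_maps_into (s : seq (endo hV)) S :
    (forall f, f \in s -> f \in maps_into S S) ->
  (<<1 & s>> <= maps_into S S)%VS.
Proof.
move=> sS; have L1 : (1 <= maps_into S S)%VS.
  by rewrite -memvE; apply/maps_intoP => x; rewrite id_lfunE.
apply: agenv_sub_modl => //; apply: subv_trans (maps_intoM S S S).
by rewrite prodvSl // subv_add L1; apply/span_subvP.
Qed.

Lemma maps_into_nilpotent (W : nat -> {vspace V}) (J : {vspace endo hV}) m :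
    W 0%N = 0%VS -> W m = fullv ->
    (forall r, (r < m)%N -> (J <= maps_into (W r.+1) (W r))%VS) ->
  (J ^+ m = 0)%VS.
Proof.
move=> W0 Wm lowJ; apply/eqP; rewrite -subv0; apply/subvP => f Jf.
suff /subvP/(_ f Jf)/maps_intoP fW0 : (J ^+ m <= maps_into (W m) (W 0%N))%VS.
  rewrite memv0; apply/eqP/lfunP => x; rewrite zero_lfunE.
  by apply/eqP; rewrite -memv0 -W0; apply: fW0; rewrite Wm memvf.
elim: {Jf Wm} m lowJ => [|m IHm] lowJ.
  by rewrite expv0 -memvE; apply/maps_intoP => x; rewrite id_lfunE.
(* The rightmost factor acts first, from [W m.+1] to [W m]. *)
rewrite expvSr; apply: subv_trans (maps_intoM _ (W m) _).
by apply: prodvS; [apply: IHm => r /ltnW/lowJ | apply: lowJ].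
Qed.

End MapsInto.

Lemma memv_prod (F : fieldType) (A : falgType F) (J : {vspace A}) m
    (f : 'I_m -> A) :
  (forall i, f i \in J) -> \prod_(i < m) f i \in (J ^+ m)%VS.
Proof.
elim: m f => [|m IHm] f Jf; first by rewrite big_ord0 memv_line.
by rewrite big_ord_recl expvSl memv_mul // IHm.
Qed.

(** * Algebras with two generators and the ideal of the second *)

Section TwoGenerators.
Variables (F : fieldType) (A : falgType F) (a b : A).

Let G : {vspace A} := <<1 & [:: a; b]>>%VS.
Let J : {vspace A} := (G * <[b]> * G)%VS.
Let T : {vspace A} := <<1 & [:: a; a^-1]>>%VS.

Lemma adjoin1 (s : seq A) : 1 \in <<1 & s>>%VS.
Proof. by rewrite memvE sub1_agenv. Qed.

Lemma two_gen_mem : a \in G /\ b \in G.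
Proof. by split; apply: seqv_sub_adjoin; rewrite !inE eqxx ?orbT. Qed.

Lemma two_gen_left_ideal : left_ideal G J.
Proof.
have [_ Gb] := two_gen_mem; split; last by rewrite !prodvA agenvM.
by rewrite prodv_sub ?prodv_sub // -memvE.
Qed.

Lemma two_gen_right_ideal : (J * G <= J)%VS.
Proof. by rewrite -prodvA agenvM. Qed.

Lemma two_gen_memJ : b \in J.
Proof. by rewrite -[b]mulr1 -[b]mul1r !memv_mul ?memv_line ?adjoin1. Qed.

Lemma adjoin_inv_sub : (T <= G)%VS.
Proof.
have [Ga _] := two_gen_mem; rewrite -[G]agenv_id agenvS // subv_add.
rewrite sub1_agenv; apply/span_subvP => x.
(* A finite-dimensional unital subalgebra is closed under inversion; for a non-unit, [a^-1] is [a]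
   by convention. *)
by rewrite !inE => /pred2P[]-> //; rewrite /G agenvE memvV.
Qed.

(** [T + J] contains 1 and is stable under left multiplication by both generators: a T lies in [T],
    a J in [J], and b (T + J) in G b G. *)
Lemma two_gen_complement : (G <= T + J)%VS.
Proof.
have [Ga Gb] := two_gen_mem; have [sJG sGJ] := two_gen_left_ideal.
apply: agenv_sub_modl.
  by apply: subv_trans (addvSl _ _); apply: sub1_agenv.
rewrite span_cons span_seq1 !prodvDl prod1v subv_add subvv subv_add /=.
rewrite prodvDr; apply/andP; split; first apply: addvS.
- rewrite prodv_sub // -memvE.
  by apply: seqv_sub_adjoin; rewrite inE eqxx.
- by apply: subv_trans sGJ; rewrite prodvSl // -memvE.
apply: subv_trans (addvSr _ _); apply: prodvS.
  by rewrite -[X in (X <= _)%VS]prod1v prodvSl // sub1_agenv.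
by rewrite subv_add adjoin_inv_sub.
Qed.

Lemma two_gen_exprz (k : int) : a ^ k \in G.
Proof.
have [Ga _] := two_gen_mem.
have GX m : a ^+ m \in G.
  elim: m => [|m IHm]; first by rewrite expr0 adjoin1.
  by rewrite exprS /G agenvE memvM.
case: k => m; first exact: GX.
by rewrite NegzE /= /exprz /G agenvE memvV; apply: GX.
Qed.

End TwoGenerators.

(** * The subspaces W_r and the action of Theta and Xi on them *)

Section ChebyshevChain.
Variables (F : fieldType) (E : vectType F) (R sigma : 'End(E)).
Implicit Types (S T : {vspace E}) (x y : E) (w : (E * E)%type).

Definition inl0 x : (E * E)%type := (x, 0).

Fact inl0_is_linear : linear inl0.
Proof. by move=> k x y; rewrite /inl0; congr (_, _); rewrite /= scaler0 addr0. Qed.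

HB.instance Definition _ :=
  GRing.isLinear.Build F E (E * E)%type _ inl0 inl0_is_linear.

(** For bijective [R] and [S] stable under [chebC R], this is the smallest Theta-stable subspace
    containing [inl0] of [S]. *)
Definition cheb_level S : {vspace (E * E)%type} :=
  (linfun inl0 @: S + chebTheta R @: (linfun inl0 @: S))%VS.

Lemma cheb_levelP S w :
  reflect (exists2 x, x \in S
             & exists2 y, y \in S & w = inl0 x + chebTheta R (inl0 y))
          (w \in cheb_level S).
Proof.
apply: (iffP memv_addP) => [[_ /memv_imgP[x Sx ->]] | [x Sx [y Sy ->]]].
  move=> [_ /memv_imgP[_ /memv_imgP[y Sy ->] ->] ->].
  by exists x => //; exists y; rewrite ?lfunE.
exists (inl0 x); first by apply/memv_imgP; exists x; rewrite ?lfunE.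
exists (chebTheta R (inl0 y)) => //.
by apply/memv_img/memv_imgP; exists y; rewrite ?lfunE.
Qed.

Lemma cheb_level0 : cheb_level 0 = 0%VS.
Proof. by rewrite /cheb_level !limg0 addv0. Qed.

Lemma chebTheta_inl0 x :
  chebTheta R (inl0 x) = ((R^-1)%VF x, R x - (R^-1)%VF x).
Proof.
by rewrite block_endoE /= zero_lfunE linear0 !addr0 add_lfunE opp_lfunE.
Qed.

Lemma chebXi_inl0 x : chebXi sigma (inl0 x) = 0.
Proof. by rewrite block_endoE /= !zero_lfunE linear0 !addr0. Qed.

Lemma chebXi_pair w : chebXi sigma w = inl0 (sigma w.2).
Proof. by rewrite block_endoE /= !zero_lfunE add0r addr0. Qed.

Lemma chebXiTheta_inl0 x :
  chebXi sigma (chebTheta R (inl0 x)) = inl0 (chebD R sigma x).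
Proof.
by rewrite chebTheta_inl0 chebXi_pair comp_lfunE add_lfunE opp_lfunE.
Qed.

(* The relation Theta^2 = C Theta - 1, on E (+) 0. *)
Lemma chebTheta2_inl0 x : bijective R ->
  chebTheta R (chebTheta R (inl0 x)) = chebTheta R (inl0 (chebC R x)) - inl0 x.
Proof.
move=> bijR; have kerR : lker R == 0%VS by apply/lker0P/bij_inj.
rewrite !chebTheta_inl0 block_endoE /= !add_lfunE !opp_lfunE zero_lfunE addr0.
rewrite !linearD !linearN /= (lker0_lfunK kerR) (lker0_lfunVK kerR).
congr (_, _); rewrite /=; first by rewrite [x + _]addrC addrK.
by rewrite subr0 -[RHS]addrA addNKr [LHS]addrC addrA subrK.
Qed.

Lemma chebTheta_level S : bijective R -> (chebC R @: S <= S)%VS ->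
  {in cheb_level S, forall w, chebTheta R w \in cheb_level S}.
Proof.
move=> bijR /subvP sCS _ /cheb_levelP[x Sx [y Sy ->]].
(* Theta (x + Theta y) = - y + Theta (x + C y), by the quadratic relation. *)
apply/cheb_levelP; exists (- y); first by rewrite memvN.
exists (x + chebC R y); first by rewrite memvD // sCS // memv_img.
rewrite !linearD linearN /= chebTheta2_inl0 //.
by rewrite addrA [RHS]addrC.
Qed.

Lemma chebXi_level S T : (chebD R sigma @: S <= T)%VS ->
  {in cheb_level S, forall w, chebXi sigma w \in cheb_level T}.
Proof.
move=> /subvP sDS _ /cheb_levelP[x Sx [y Sy ->]].
apply/cheb_levelP; exists (chebD R sigma y); first by rewrite sDS // memv_img.
exists 0; first exact: mem0v.
by rewrite linearD /= chebXi_inl0 chebXiTheta_inl0 !linear0 addr0 add0r.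
Qed.

End ChebyshevChain.

(** * Nilpotency of the ideal and the nonzero word *)

Section ChebyshevDatum.
Variables (F : fieldType) (E : vectType F) (n : nat) (R sigma : 'End(E)).
Variables (Fl : nat -> {vspace E}) (h : chebyshev_datum n R sigma Fl).

Let Theta : cheb_alg h := chebTheta R.
Let Xi : cheb_alg h := chebXi sigma.
Let G : {vspace cheb_alg h} := <<1 & [:: Theta; Xi]>>%VS.
Let J : {vspace cheb_alg h} := (G * <[Xi]> * G)%VS.

(** The value at [n.+1] is the whole space, put above W_n, which need not be everything. *)
Definition cheb_chain r : {vspace (E * E)%type} :=
  if (r <= n)%N then cheb_level R (Fl r) else fullv.

Lemma cheb_chain0 : cheb_chain 0 = 0%VS.
Proof. by rewrite /cheb_chain (cheb_flag0 h) cheb_level0. Qed.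

Lemma cheb_chain_stable r : (r <= n)%N ->
  (chebC R @: Fl r <= Fl r)%VS /\ (chebD R sigma @: Fl r <= Fl r.-1)%VS.
Proof.
case: r => [|r] ler; first by rewrite (cheb_flag0 h) !limg0 subvv.
by split; [apply: (cheb_H1 h) | apply: (cheb_H2 h)].
Qed.

Lemma chebXi_chain r w :
  w \in cheb_chain r.+1 -> chebXi sigma w \in cheb_chain r.
Proof.
rewrite /cheb_chain; case: ltnP => [ltrn|lenr].
  by rewrite (ltnW ltrn); apply/chebXi_level/(cheb_chain_stable ltrn).2.
move=> _; case: leqP => [lern|_]; last exact: memvf.
(* At the top step, Xi sends every vector into E (+) 0, which lies in W_n because F_n = E. *)
have -> : r = n by apply/eqP; rewrite eqn_leq lern.
rewrite (cheb_flagn h) chebXi_pair; apply/cheb_levelP.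
exists (sigma w.2); first exact: memvf.
by exists 0; rewrite ?mem0v // !linear0 addr0.
Qed.

Lemma chebTheta_chain r w :
  w \in cheb_chain r -> chebTheta R w \in cheb_chain r.
Proof.
rewrite /cheb_chain; case: leqP => [lern|_ _]; last exact: memvf.
exact: chebTheta_level (cheb_R_GL h) (cheb_chain_stable lern).1 _.
Qed.

Lemma cheb_chain_increasing r w :
  w \in cheb_chain r -> w \in cheb_chain r.+1.
Proof.
rewrite /cheb_chain; case: (ltnP r n) => [ltrn|_ _]; last exact: memvf.
rewrite (ltnW ltrn); apply: subvP; have [sFl _] := cheb_flag_strict h ltrn.
by rewrite addvS ?limgS.
Qed.

Lemma cheb_ideal_nilpotent : (J ^+ n.+1 = 0)%VS.
Proof.
apply: (maps_into_nilpotent (W := cheb_chain)).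
- exact: cheb_chain0.
- by rewrite /cheb_chain ltnn.
move=> r _.
have GW k : (G <= maps_into _ (cheb_chain k) (cheb_chain k))%VS.
  apply: adjoin_maps_into => f; rewrite !inE => /pred2P[]->; apply/maps_intoP => w.
    exact: chebTheta_chain.
  (* Xi preserves each level because it lowers it within an increasing chain; the bottom level is
     0. *)
  case: k => [|k] Ww; last by apply/cheb_chain_increasing/chebXi_chain.
  by move: Ww; rewrite cheb_chain0 memv0 => /eqP->; rewrite linear0 mem0v.
(* In a product g Xi g' only Xi changes the level. *)
apply: subv_trans (maps_intoM _ _ (cheb_chain r.+1) _).
apply: prodvS (GW r.+1); apply: subv_trans (maps_intoM _ _ (cheb_chain r) _).
apply: prodvS (GW r) _; rewrite -memvE; apply/maps_intoP => w.
exact: chebXi_chain.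
Qed.

(** The last Xi lands in E (+) 0, where each Xi Theta acts as D. *)
Lemma cheb_wordE x y m :
  ((Xi * Theta) ^+ m * Xi : 'End((E * E)%type)) (x, y)
    = inl0 (lfun_pow (chebD R sigma) m (sigma y)).
Proof.
elim: m => [|m IHm].
  by rewrite expr0 mul1r chebXi_pair id_lfunE.
have mulXT (f : cheb_alg h) w : (Xi * Theta * f : 'End((E * E)%type)) w
    = chebXi sigma (chebTheta R ((f : 'End((E * E)%type)) w)).
  by rewrite endo_mulE comp_lfunE endo_mulE comp_lfunE.
rewrite exprS -mulrA mulXT IHm chebXiTheta_inl0.
by rewrite [in RHS]/lfun_pow iterS comp_lfunE.
Qed.

Lemma cheb_word_neq0 : (Xi * Theta) ^+ n.-1 * Xi <> 0.
Proof.
move=> word0; apply: (cheb_H3 h); apply/lfunP => x.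
have [tau _ tauK] := cheb_sigma_GL h.
(* Taking y to be the preimage of [x] under [sigma] turns D^(n-1) sigma y into D^(n-1) x. *)
have := cheb_wordE 0 (tau x) n.-1.
by rewrite word0 tauK !zero_lfunE => -[].
Qed.

End ChebyshevDatum.

Theorem theorem7p3 (F : fieldType) (E : vectType F) (n : nat)
    (R sigma : 'End(E)) (Fl : nat -> {vspace E})
    (h : chebyshev_datum n R sigma Fl) :
  let Theta : cheb_alg h := chebTheta R in
  let Xi : cheb_alg h := chebXi sigma in
  let G : {vspace cheb_alg h} := <<1 & [:: Theta; Xi]>>%VS in
  let J : {vspace cheb_alg h} := (G * <[Xi]> * G)%VS in
  [/\ forall (M : nat) (k : 'I_M -> int), (n <= M)%N ->
        (\prod_(i < M) (Xi * Theta ^ k i)) * Xi = 0,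
      (Xi * Theta) ^+ n.-1 * Xi <> 0,
      forall x : cheb_alg h, x \in J <-> in_jacobson_radical G x,
      (J ^+ n)%VS <> 0%VS /\ (J ^+ n.+1)%VS = 0%VS
    & (* the layers J^r / J^(r+1), with J^0 = G, are nonzero exactly for r <= n *)
      forall r : nat,
        (ideal_power G J r.+1 <= ideal_power G J r)%VS /\
        (ideal_power G J r <> ideal_power G J r.+1 <-> (r < n.+1)%N)].
Proof.
move=> Theta Xi G J.
have JS0 : (J ^+ n.+1)%VS = 0%VS := cheb_ideal_nilpotent h.
have word_neq0 : (Xi * Theta) ^+ n.-1 * Xi <> 0 := @cheb_word_neq0 _ _ _ _ _ _ h.
have idJ : left_ideal G J := two_gen_left_ideal Theta Xi.
have sJGJ : (J * G <= J)%VS := two_gen_right_ideal Theta Xi.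
have G1 : 1 \in G := adjoin1 _.
have JXi : Xi \in J := two_gen_memJ Theta Xi.
(* The closing [Xi] is an extra letter, hence the exponent [M.+1]. *)
have wordJ M (k : 'I_M -> int) :
    \prod_(i < M) (Xi * Theta ^ k i) * Xi \in (J ^+ M.+1)%VS.
  rewrite expvSr memv_mul // memv_prod // => i.
  by apply: (prodvP sJGJ) => //; apply: two_gen_exprz.
have Jn0 : (J ^+ n)%VS <> 0%VS.
  move=> Jn0; apply: word_neq0; apply/eqP; rewrite -memv0 -Jn0.
  (* With n - 1 exponents equal to one, the nonzero word has n letters Xi and so lies in J^n. *)
  have := wordJ n.-1 (fun=> 1%Z); rewrite prednK; last exact: ltnW (cheb_length h).
  by rewrite prodr_const card_ord expr1z.
split=> //.
- move=> M k lenM; apply/eqP; rewrite -memv0.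
  suff <- : (J ^+ M.+1)%VS = 0%VS by apply: wordJ.
  by rewrite -(subnKC (lenM : n.+1 <= M.+1)%N) expvD JS0 prod0v.
- apply: (@nilpotent_ideal_semisimple_complement _ _ G <<1 & [:: Theta; Theta^-1]>>%VS J n.+1) => //.
  + by rewrite agenvM.
  + exact: adjoin_inv_sub.
  + exact: adjoin1.
  + by rewrite agenvM.
  + exact: two_gen_complement.
  + exact: cheb_H4 h.
exact: ideal_power_layers.
Qed.
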